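(* Let $\mathsf{CS}$ be a constant specification for $\mathsf{LP}^B$. Every polynomial $\mathsf{LP}^B_{\mathsf{CS}}$ algebra is bi-isomorphic to a polynomial $\mathsf{LP}^B_{\mathsf{CS}}$ set algebra.
   Context: **Language of $\mathsf{LP}^B$.** Let $\mathsf{Const}$, $\mathsf{Var}$, $\mathsf{Prop}$ be the sets of proof constants, proof variables and propositional atoms; $\mathbf 0$ is a distinguished term symbol not in $\mathsf{Const}$. Terms ($\mathsf{Term}$) and formulas ($\mathsf{Form}$): $s,t ::= c\mid x\mid \mathbf 0\mid -t\mid t+s\mid t\cdot s\mid\,!t$ and $\varphi,\psi ::= p\mid t\approx s\mid\bot\mid\neg\varphi\mid\varphi\vee\psi\mid t:\varphi$, with $c\in\mathsf{Const}$, $x\in\mathsf{Var}$, $p\in\mathsf{Prop}$. Abbreviations: $\mathbf 1:=-\mathbf 0$, $s\odot t:=-(-s+-t)$, $\varphi\to\psi:=\neg\varphi\vee\psi$; $\wedge,\leftrightarrow$ as usual. **Logic.** Axiom schemes of $\mathsf{LP}^B_\emptyset$: $\varphi\to(\varphi\vee\psi)$; $(\varphi\vee\psi)\to(\psi\vee\varphi)$; $(\varphi\vee\varphi)\to\varphi$; $(\varphi\to\psi)\to((\chi\vee\varphi)\to(\chi\vee\psi))$; $\bot\to\varphi$; $s:(\varphi\to\psi)\to(t:\varphi\to(s\cdot t):\psi)$; $(s:\varphi\vee t:\varphi)\to(s+t):\varphi$; $t:\varphi\to\varphi$; $t:\varphi\to\,!t:t:\varphi$; the Boolean axioms for terms: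 $s+t\approx t+s$, $s\odot t\approx t\odot s$, $s+(t+u)\approx(s+t)+u$, $s\odot(t\odot u)\approx(s\odot t)\odot u$, $s+\mathbf 0\approx s$, $s\odot\mathbf 1\approx s$, $s+(-s)\approx\mathbf 1$, $s\odot(-s)\approx\mathbf 0$, $s+(t\odot u)\approx(s+t)\odot(s+u)$, $s\odot(t+u)\approx(s\odot t)+(s\odot u)$; and equality axioms $t\approx t$ and $(s\approx t\wedge\varphi[x/s])\to\varphi[x/t]$, where $\varphi[x/s]$ is the result of substituting $s$ for $x$ in $\varphi$. A constant specification $\mathsf{CS}$ for $\mathsf{LP}^B$ is a set of formulas $c:\varphi$ with $c\in\mathsf{Const}$ and $\varphi$ an axiom instance. $\mathsf{LP}^B_{\mathsf{CS}}$ adds the formulas of $\mathsf{CS}$ as axioms; its rules are Modus Ponens and Int: from $\varphi$ infer $\mathbf 1:\varphi$. **Boolean algebras** are written $(A,0,\ominus,\oplus)$ (least element, complement, join), with $1:=\ominus 0$, $a\otimes b:=\ominus(\ominus a\oplus\ominus b)$, $a\Rightarrow b:=\ominus a\oplus b$, $a\le b$ iff $a\Rightarrow b=1$. **Polynomials.** Let $\mathcal{T}=(T,0_{\mathcal T},-_{\mathcal T},+_{\mathcal T},\cdot_{\mathcal T},!_{\mathcal T})$ where $(T,0_{\mathcal T},-_{\mathcal T},+_{\mathcal T})$ is a Boolean algebra, $\cdot_{\mathcal T}:T\times T\to T$, $!_{\mathcal T}:T\to T$; $1_{\mathcal T}:=-_{\mathcal T}0_{\mathcal T}$. $T[\mathsf{Var}]$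 is the set of (Boolean) polynomials with variables in $\mathsf{Var}$ and coefficients in $T$. Two polynomials are equal, $f\stackrel{p}{=}g$, iff $v(f)=v(g)$ for every $v:\mathsf{Var}\to T$, where $v(f)$ is obtained by replacing every occurrence of every variable by its image under $v$. The Boolean structure of $T$ induces a Boolean algebra $(T[\mathsf{Var}],0_{\mathcal T},-_{\mathcal T[\mathsf{Var}]},+_{\mathcal T[\mathsf{Var}]})$. $\mathcal T[\mathsf{Var}]$ denotes this Boolean algebra together with operations $\cdot_{\mathcal T[\mathsf{Var}]}:T[\mathsf{Var}]\times T[\mathsf{Var}]\to T[\mathsf{Var}]$ and $!_{\mathcal T[\mathsf{Var}]}:T[\mathsf{Var}]\to T[\mathsf{Var}]$ which are arbitrary extensions of $\cdot_{\mathcal T}$ and $!_{\mathcal T}$. **Pre polynomial $\mathsf{LP}^B_{\mathsf{CS}}$ algebra** (over $\mathcal T[\mathsf{Var}]$): a tuple $\mathcal{A}=(A,0,\ominus,\oplus,\Box_\alpha,I)_{\alpha\in T[\mathsf{Var}]}$ where $(A,0,\ominus,\oplus)$ is a Boolean algebra, $I:\mathsf{Const}\cup\{\mathbf 0\}\to T$ with $I(\mathbf 0)=0_{\mathcal T}$, and functions $\Box_\alpha:\mathsf{Form}\to A$ satisfy, for all $\varphi,\psi\in\mathsf{Form}$ and $\alpha,\beta\in T[\mathsf{Var}]$: $\Box_\alpha(\varphi\to\psi)\otimes\Box_\beta(\varphi)\le\Box_{\alpha\cdot_{\mathcal T[\mathsf{Var}]}\beta}(\psi)$; $\Box_\alpha(\varphi)\oplus\Box_\beta(\varphi)\le\Box_{\alpha+_{\mathcal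 T[\mathsf{Var}]}\beta}(\varphi)$; $\Box_{1_{\mathcal T}}(\varphi)=1$ whenever $\vdash_{\mathsf{LP}^B_{\mathsf{CS}}}\varphi$; $\Box_{I(c)}(\varphi)=1$ whenever $c:\varphi\in\mathsf{CS}$. **Assignment.** $\tilde I:\mathsf{Term}\to T[\mathsf{Var}]$: $\tilde I(x)=x$ for $x\in\mathsf{Var}$; $\tilde I(c)=I(c)$ for $c\in\mathsf{Const}\cup\{\mathbf 0\}$; $\tilde I(s\ast t)=\tilde I(s)\ast_{\mathcal T[\mathsf{Var}]}\tilde I(t)$ for $\ast\in\{+,\cdot\}$; $\tilde I(\ast s)=\ast_{\mathcal T[\mathsf{Var}]}\tilde I(s)$ for $\ast\in\{-,!\}$. For a valuation $\theta:\mathsf{Prop}\to A$, $\tilde\theta:\mathsf{Form}\to A$ is given by $\tilde\theta(p)=\theta(p)$, $\tilde\theta(\bot)=0$, $\tilde\theta(\neg\varphi)=\ominus\tilde\theta(\varphi)$, $\tilde\theta(\varphi\vee\psi)=\tilde\theta(\varphi)\oplus\tilde\theta(\psi)$ (so $\tilde\theta(\varphi\to\psi)=\tilde\theta(\varphi)\Rightarrow\tilde\theta(\psi)$), $\tilde\theta(t:\varphi)=\Box_{\tilde I(t)}(\varphi)$, and $\tilde\theta(s\approx t)=1$ if $\tilde I(s)\stackrel{p}{=}\tilde I(t)$, $=0$ otherwise. **Polynomial $\mathsf{LP}^B_{\mathsf{CS}}$ algebra:** a pre polynomial $\mathsf{LP}^B_{\mathsf{CS}}$ algebra such that for all $\varphi\in\mathsf{Form}$,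 all $t\in\mathsf{Term}$, all $\alpha\in T[\mathsf{Var}]$ and all valuations $\theta:\mathsf{Prop}\to A$: $\Box_{\tilde I(t)}(\varphi)\le\Box_{!_{\mathcal T[\mathsf{Var}]}\tilde I(t)}(t:\varphi)$ and $\Box_\alpha(\varphi)\le\tilde\theta(\varphi)$. **Set algebras.** A set algebra is a subalgebra of a power set algebra $(\mathcal{P}(X),\emptyset,\setminus,\cup)$, $\setminus$ being complement relative to $X$. A polynomial $\mathsf{LP}^B_{\mathsf{CS}}$ set algebra is a polynomial $\mathsf{LP}^B_{\mathsf{CS}}$ algebra $(A,\emptyset,\setminus,\cup,\Box_\alpha,I)_{\alpha\in B[\mathsf{Var}]}$ over $\mathcal B[\mathsf{Var}]$, with $\mathcal B=(B,\emptyset,\setminus,\cup,\cdot_{\mathcal B},!_{\mathcal B})$, where both $(A,\emptyset,\setminus,\cup)$ and $(B,\emptyset,\setminus,\cup)$ are set algebras. **Bi-isomorphism** between polynomial $\mathsf{LP}^B_{\mathsf{CS}}$ algebras $\mathcal A$ over $\mathcal T[\mathsf{Var}]$ and $\mathcal A'$ over $\mathcal T'[\mathsf{Var}]$: a pair $(f,g)$ of Boolean isomorphisms $f:(A,0,\ominus,\oplus)\to(A',0',\ominus',\oplus')$ and $g:(T,0_{\mathcal T},-_{\mathcal T},+_{\mathcal T})\to(T',0_{\mathcal T'},-_{\mathcal T'},+_{\mathcal T'})$, with $g$ extended to $g:T[\mathsf{Var}]\to T'[\mathsf{Var}]$ by $g(x)=x$ for $x\in\mathsf{Var}$, such that $f(\Box_\alpha(\varphi))=\Box'_{g(\alpha)}(\varphi)$,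 $g(I(c))=I'(c)$, $g(\alpha\cdot_{\mathcal T[\mathsf{Var}]}\beta)=g(\alpha)\cdot_{\mathcal T'[\mathsf{Var}]}g(\beta)$, $g(!_{\mathcal T[\mathsf{Var}]}\alpha)=\,!_{\mathcal T'[\mathsf{Var}]}g(\alpha)$ for all $\alpha,\beta\in T[\mathsf{Var}]$, $\varphi\in\mathsf{Form}$, $c\in\mathsf{Const}\cup\{\mathbf 0\}$. *)

(* Defs.v *)
From HB Require Import structures.
From mathcomp Require Import all_boot all_order.
From mathcomp Require Import all_classical.

Set Implicit Arguments.
Unset Strict Implicit.
Unset Printing Implicit Defensive.
Import Order.Theory.
Local Open Scope order_scope.
Local Open Scope quotient_scope.

(* Boolean algebras are [ctbDistrLatticeType]s: 0, complement, join, meet,     *)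
(* 1 and the order are [\bot], [~` a], [a `|` b], [a `&` b], [\top], [a <= b]. *)
(* The next lemma checks the reading of [a <= b] as (a => b) = 1.              *)

Lemma le_implE (d : Order.disp_t) (A : ctbDistrLatticeType d) (a b : A) :
  (a <= b) = (~` a `|` b == \top).
Proof.
apply/idP/eqP => [ab|ab1].
  by apply/le_anti; rewrite lex1 -(joinCx a) leU2.
by rewrite -[leLHS]meetx1 -ab1 meetUr meetxC join0x leIr.
Qed.

Section Syntax.

Context (Const : Type) (Var : eqType) (Atom : Type).

Inductive term : Type :=
| TConst of Const
| TVar of Var
| TZero
| TNeg of term
| TAdd of term & term
| TApp of term & term
| TBang of term.

Inductive form : Type :=
| FAtom of Atom
| FEq of term & term
| FBot
| FNeg of form
| FOr of form & form
| FJust of term & form.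

Definition TOne : term := TNeg TZero.
Definition TMul (s t : term) : term := TNeg (TAdd (TNeg s) (TNeg t)).
Definition FImp (p q : form) : form := FOr (FNeg p) q.
Definition FAnd (p q : form) : form := FNeg (FOr (FNeg p) (FNeg q)).

Fixpoint tsubst (x : Var) (s t : term) : term :=
  match t with
  | TConst c => TConst c
  | TVar y => if y == x then s else TVar y
  | TZero => TZero
  | TNeg u => TNeg (tsubst x s u)
  | TAdd u v => TAdd (tsubst x s u) (tsubst x s v)
  | TApp u v => TApp (tsubst x s u) (tsubst x s v)
  | TBang u => TBang (tsubst x s u)
  end.

Fixpoint fsubst (x : Var) (s : term) (p : form) : form :=
  match p with
  | FAtom a => FAtom a
  | FEq u v => FEq (tsubst x s u) (tsubst x s v)
  | FBot => FBot
  | FNeg q => FNeg (fsubst x s q)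
  | FOr q r => FOr (fsubst x s q) (fsubst x s r)
  | FJust t q => FJust (tsubst x s t) (fsubst x s q)
  end.

Inductive lp_axiom : form -> Prop :=
| ax_orI p q : lp_axiom (FImp p (FOr p q))
| ax_orC p q : lp_axiom (FImp (FOr p q) (FOr q p))
| ax_orr p : lp_axiom (FImp (FOr p p) p)
| ax_orS p q r : lp_axiom (FImp (FImp p q) (FImp (FOr r p) (FOr r q)))
| ax_bot p : lp_axiom (FImp FBot p)
| ax_app s t p q :
    lp_axiom (FImp (FJust s (FImp p q)) (FImp (FJust t p) (FJust (TApp s t) q)))
| ax_sum s t p :
    lp_axiom (FImp (FOr (FJust s p) (FJust t p)) (FJust (TAdd s t) p))
| ax_refl t p : lp_axiom (FImp (FJust t p) p)
| ax_bang t p : lp_axiom (FImp (FJust t p) (FJust (TBang t) (FJust t p)))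
| ax_addC s t : lp_axiom (FEq (TAdd s t) (TAdd t s))
| ax_mulC s t : lp_axiom (FEq (TMul s t) (TMul t s))
| ax_addA s t u : lp_axiom (FEq (TAdd s (TAdd t u)) (TAdd (TAdd s t) u))
| ax_mulA s t u : lp_axiom (FEq (TMul s (TMul t u)) (TMul (TMul s t) u))
| ax_add0 s : lp_axiom (FEq (TAdd s TZero) s)
| ax_mul1 s : lp_axiom (FEq (TMul s TOne) s)
| ax_addN s : lp_axiom (FEq (TAdd s (TNeg s)) TOne)
| ax_mulN s : lp_axiom (FEq (TMul s (TNeg s)) TZero)
| ax_addM s t u :
    lp_axiom (FEq (TAdd s (TMul t u)) (TMul (TAdd s t) (TAdd s u)))
| ax_mulD s t u :
    lp_axiom (FEq (TMul s (TAdd t u)) (TAdd (TMul s t) (TMul s u)))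
| ax_eqxx t : lp_axiom (FEq t t)
| ax_eqS s t x p :
    lp_axiom (FImp (FAnd (FEq s t) (fsubst x s p)) (fsubst x t p)).

Definition constant_spec (CS : set form) : Prop :=
  forall p, CS p -> exists c q, p = FJust (TConst c) q /\ lp_axiom q.

Inductive provable (CS : set form) : form -> Prop :=
| pr_ax p : lp_axiom p -> provable CS p
| pr_cs p : CS p -> provable CS p
| pr_mp p q : provable CS (FImp p q) -> provable CS p -> provable CS q
| pr_int p : provable CS p -> provable CS (FJust TOne p).

End Syntax.

Arguments TConst {Const Var}.
Arguments TVar {Const Var}.
Arguments TZero {Const Var}.
Arguments FAtom {Const Var Atom}.
Arguments FEq {Const Var Atom}.
Arguments FBot {Const Var Atom}.

(* Polynomial expressions; [polynomial] below is their quotient by semantic    *)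
(* equality, so that equality of polynomials is Leibniz equality.              *)

Inductive pexpr (Var T : Type) : Type :=
| PCoef of T
| PVar of Var
| PNeg of pexpr Var T
| PAdd of pexpr Var T & pexpr Var T.

Arguments PCoef {Var T}.
Arguments PVar {Var T}.

HB.instance Definition _ (Var T : Type) := gen_eqMixin (pexpr Var T).
HB.instance Definition _ (Var T : Type) := gen_choiceMixin (pexpr Var T).

Fixpoint pexpr_map (Var T T' : Type) (g : T -> T') (e : pexpr Var T) :
    pexpr Var T' :=
  match e with
  | PCoef a => PCoef (g a)
  | PVar x => PVar x
  | PNeg e1 => PNeg (pexpr_map g e1)
  | PAdd e1 e2 => PAdd (pexpr_map g e1) (pexpr_map g e2)
  end.

Section Polynomials.

Context (Var : Type) (d : Order.disp_t) (T : ctbDistrLatticeType d).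

Fixpoint peval (v : Var -> T) (e : pexpr Var T) : T :=
  match e with
  | PCoef a => a
  | PVar x => v x
  | PNeg e1 => ~` peval v e1
  | PAdd e1 e2 => peval v e1 `|` peval v e2
  end.

Definition peq : rel (pexpr Var T) :=
  fun e1 e2 => `[< forall v, peval v e1 = peval v e2 >].

Lemma peq_refl : reflexive peq.
Proof. by move=> e; apply/asboolP. Qed.

Lemma peq_sym : symmetric peq.
Proof. by move=> e1 e2; apply/asboolP/asboolP => h v; rewrite h. Qed.

Lemma peq_trans : transitive peq.
Proof.
by move=> e2 e1 e3 /asboolP h1 /asboolP h2; apply/asboolP => v; rewrite h1.
Qed.

Canonical peq_equiv := EquivRel peq peq_refl peq_sym peq_trans.

Definition polynomial : Type := {eq_quot peq_equiv}.

HB.instance Definition _ := Choice.on polynomial.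
HB.instance Definition _ := EqQuotient.on polynomial.

Implicit Types p q r : polynomial.

Definition pcoef (a : T) : polynomial := \pi_polynomial (PCoef a).
Definition pvar (x : Var) : polynomial := \pi_polynomial (PVar x).
Definition pneg p : polynomial := \pi_polynomial (PNeg (repr p)).
Definition padd p q : polynomial := \pi_polynomial (PAdd (repr p) (repr q)).
Definition pmul p q : polynomial := pneg (padd (pneg p) (pneg q)).

Definition pval (v : Var -> T) p : T := peval v (repr p).

Lemma pval_pi v e : pval v (\pi_polynomial e) = peval v e.
Proof.
have /eqmodP/asboolP h : repr (\pi_polynomial e) = e %[mod polynomial].
  by rewrite reprK.
exact: h.
Qed.

Lemma polyP p q : (forall v, pval v p = pval v q) <-> p = q.
Proof.
split=> [h|-> //]; rewrite -[p]reprK -[q]reprK.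
by apply/eqmodP/asboolP.
Qed.

Lemma pval_coef v a : pval v (pcoef a) = a.
Proof. by rewrite pval_pi. Qed.

Lemma pval_var v x : pval v (pvar x) = v x.
Proof. by rewrite pval_pi. Qed.

Lemma pval_neg v p : pval v (pneg p) = ~` pval v p.
Proof. by rewrite pval_pi. Qed.

Lemma pval_add v p q : pval v (padd p q) = pval v p `|` pval v q.
Proof. by rewrite pval_pi. Qed.

Lemma pval_mul v p q : pval v (pmul p q) = pval v p `&` pval v q.
Proof. by rewrite pval_neg pval_add !pval_neg complU !complK. Qed.

Definition pvalE :=
  (pval_coef, pval_var, pval_neg, pval_add, pval_mul).

Lemma pmulC : commutative pmul.
Proof. by move=> p q; apply/polyP => v; rewrite !pvalE meetC. Qed.
Lemma paddC : commutative padd.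
Proof. by move=> p q; apply/polyP => v; rewrite !pvalE joinC. Qed.
Lemma pmulA : associative pmul.
Proof. by move=> p q r; apply/polyP => v; rewrite !pvalE meetA. Qed.
Lemma paddA : associative padd.
Proof. by move=> p q r; apply/polyP => v; rewrite !pvalE joinA. Qed.
Lemma paddKmul q p : pmul p (padd p q) = p.
Proof. by apply/polyP => v; rewrite !pvalE joinKI. Qed.
Lemma pmulKadd q p : padd p (pmul p q) = p.
Proof. by apply/polyP => v; rewrite !pvalE meetKU. Qed.
Lemma pmulDl : left_distributive pmul padd.
Proof. by move=> p q r; apply/polyP => v; rewrite !pvalE meetUl. Qed.
Lemma pmulpp : idempotent_op pmul.
Proof. by move=> p; apply/polyP => v; rewrite !pvalE meetxx. Qed.

Fact polynomial_display : Order.disp_t. Proof. exact: d. Qed.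

HB.instance Definition _ :=
  @Order.isMeetJoinDistrLattice.Build polynomial_display polynomial
    (fun p q => pmul p q == p) (fun p q => (q != p) && (pmul p q == p))
    pmul padd (fun _ _ => erefl) (fun _ _ => erefl)
    pmulC paddC pmulA paddA paddKmul pmulKadd pmulDl pmulpp.

Lemma pcoef0_le p : pcoef \bot <= p.
Proof. by apply/eqP/polyP => v; rewrite !pvalE meet0x. Qed.

Lemma pcoef1_ge p : p <= pcoef \top.
Proof. by apply/eqP/polyP => v; rewrite !pvalE meetx1. Qed.

HB.instance Definition _ :=
  @Order.hasBottom.Build polynomial_display polynomial (pcoef \bot) pcoef0_le.
HB.instance Definition _ :=
  @Order.hasTop.Build polynomial_display polynomial (pcoef \top) pcoef1_ge.

Lemma paddN p : p `|` pneg p = \top.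
Proof.
apply/(polyP (padd p (pneg p)) (pcoef \top)) => v.
by rewrite pval_add pval_neg pval_coef joinxC.
Qed.

Lemma pmulN p : p `&` pneg p = \bot.
Proof.
apply/(polyP (pmul p (pneg p)) (pcoef \bot)) => v.
by rewrite pval_mul pval_neg pval_coef meetxC.
Qed.

HB.instance Definition _ :=
  @Order.TBDistrLattice_hasComplement.Build polynomial_display polynomial
    pneg paddN pmulN.

(* The operations [.] and [!] on T and arbitrary extensions of them to         *)
(* polynomials; the Boolean parts of both structures are those of [T] and of   *)
(* [polynomial].                                                               *)
Record poly_structure := PolyStructure {
  tdot : T -> T -> T;
  tbang : T -> T;
  pdot : polynomial -> polynomial -> polynomial;
  pbang : polynomial -> polynomial;
  pdot_coef : forall a b, pdot (pcoef a) (pcoef b) = pcoef (tdot a b);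
  pbang_coef : forall a, pbang (pcoef a) = pcoef (tbang a)
}.

End Polynomials.

Arguments polynomial Var {d} T.
Arguments pcoef Var {d T}.
Arguments pvar {Var d} T.
Arguments poly_structure Var {d} T.

Lemma pneg_compl (Var : Type) d (T : ctbDistrLatticeType d)
  (p : polynomial Var T) : ~` p = pneg p.
Proof. by []. Qed.

Lemma padd_join (Var : Type) d (T : ctbDistrLatticeType d)
  (p q : polynomial Var T) : p `|` q = padd p q.
Proof. by []. Qed.

Definition bool_iso (d d' : Order.disp_t) (A : ctbDistrLatticeType d)
    (A' : ctbDistrLatticeType d') (f : A -> A') : Prop :=
  [/\ bijective f, f \bot = \bot, {morph f : a / ~` a}
    & {morph f : a b / a `|` b}].

(* The extension of g : T -> T' to polynomials that fixes the variables. It is *)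
(* independent of the chosen representative when g is a Boolean isomorphism    *)
(* ([poly_map_pi]).                                                            *)
Definition poly_map (Var : Type) (d d' : Order.disp_t)
    (T : ctbDistrLatticeType d) (T' : ctbDistrLatticeType d') (g : T -> T')
    (p : polynomial Var T) : polynomial Var T' :=
  \pi_(polynomial Var T') (pexpr_map g (repr p)).

Lemma peval_map (Var : Type) d d' (T : ctbDistrLatticeType d)
    (T' : ctbDistrLatticeType d') (g : T -> T') (v : Var -> T)
    (e : pexpr Var T) :
  bool_iso g -> peval (g \o v) (pexpr_map g e) = g (peval v e).
Proof.
case=> _ _ gN gD; elim: e => //= [e ->|e1 -> e2 ->]; first by rewrite gN.
by rewrite gD.
Qed.

Lemma poly_map_pi (Var : Type) d d' (T : ctbDistrLatticeType d)
    (T' : ctbDistrLatticeType d') (g : T -> T') (e : pexpr Var T) :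
  bool_iso g ->
  poly_map g (\pi_(polynomial Var T) e) =
    \pi_(polynomial Var T') (pexpr_map g e).
Proof.
move=> giso; apply/polyP => v; rewrite !pval_pi.
have [[h hK gK] _ _ _] := giso.
have -> : v = g \o (h \o v) by apply/funext => x /=; rewrite gK.
by rewrite !peval_map //; congr (g _); apply: (pval_pi (h \o v) e).
Qed.

Section Algebras.

Context (Const : Type) (Var : eqType) (Atom : Type).
Context (CS : set (form Const Var Atom)).
Context (dA dT : Order.disp_t).
Context (A : ctbDistrLatticeType dA) (T : ctbDistrLatticeType dT).
Context (TT : poly_structure Var T).

Local Notation term := (term Const Var).
Local Notation form := (form Const Var Atom).
Local Notation poly := (polynomial Var T).

(* [interp] has domain Const together with the symbol 0, encoded as [None].    *)
Record pre_poly_algebra := PrePolyAlgebra {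
  box : poly -> form -> A;
  interp : option Const -> T;
  interp0 : interp None = \bot;
  box_app : forall (p q : form) (a b : poly),
    box a (FImp p q) `&` box b p <= box (pdot TT a b) q;
  box_add : forall (p : form) (a b : poly),
    box a p `|` box b p <= box (a `|` b) p;
  box_one : forall p : form, provable CS p -> box (pcoef Var \top) p = \top;
  box_cs : forall (c : Const) (p : form),
    CS (FJust (TConst c) p) -> box (pcoef Var (interp (Some c))) p = \top
}.

Fixpoint tinterp (I : option Const -> T) (t : term) : poly :=
  match t with
  | TConst c => pcoef Var (I (Some c))
  | TVar x => pvar T x
  | TZero => pcoef Var (I None)
  | TNeg s => ~` tinterp I s
  | TAdd s u => tinterp I s `|` tinterp I u
  | TApp s u => pdot TT (tinterp I s) (tinterp I u)
  | TBang s => pbang TT (tinterp I s)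
  end.

Fixpoint finterp (AA : pre_poly_algebra) (theta : Atom -> A) (p : form) : A :=
  match p with
  | FAtom a => theta a
  | FEq s t =>
      if `[< tinterp (interp AA) s = tinterp (interp AA) t >] then \top
      else \bot
  | FBot => \bot
  | FNeg q => ~` finterp AA theta q
  | FOr q r => finterp AA theta q `|` finterp AA theta r
  | FJust t q => box AA (tinterp (interp AA) t) q
  end.

Record poly_algebra := PolyAlgebra {
  pre_algebra :> pre_poly_algebra;
  box_bang : forall (p : form) (t : term),
    box pre_algebra (tinterp (interp pre_algebra) t) p
      <= box pre_algebra (pbang TT (tinterp (interp pre_algebra) t)) (FJust t p);
  box_sound : forall (p : form) (a : poly) (theta : Atom -> A),
    box pre_algebra a p <= finterp pre_algebra theta p
}.

End Algebras.

Definition bi_isomorphic (Const : Type) (Var : eqType) (Atom : Type)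
    (CS : set (form Const Var Atom)) (dA dT dA' dT' : Order.disp_t)
    (A : ctbDistrLatticeType dA) (T : ctbDistrLatticeType dT)
    (TT : poly_structure Var T) (AA : poly_algebra CS A TT)
    (A' : ctbDistrLatticeType dA') (T' : ctbDistrLatticeType dT')
    (TT' : poly_structure Var T') (AA' : poly_algebra CS A' TT') : Prop :=
  exists (f : A -> A') (g : T -> T'),
    [/\ bool_iso f, bool_iso g,
        forall a p, f (box AA a p) = box AA' (poly_map g a) p &
        [/\ forall c, g (interp AA c) = interp AA' c,
            forall a b, poly_map g (pdot TT a b)
                        = pdot TT' (poly_map g a) (poly_map g b) &
            forall a, poly_map g (pbang TT a) = pbang TT' (poly_map g a)]].

(* Subalgebras of the power set algebra of X, which may be empty.              *)
Record set_algebra (X : Type) := SetAlgebra {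
  sa_sets : set (set X);
  sa_set0 : sa_sets set0;
  sa_setC : forall Y, sa_sets Y -> sa_sets (~` Y)%classic;
  sa_setU : forall Y Z, sa_sets Y -> sa_sets Z -> sa_sets (Y `|` Z)%classic
}.

Section SetAlgebra.

Context (X : Type) (S : set_algebra X).

Definition sa_pred : {pred set X} := fun Y => Y \in sa_sets S.

Record sa_elt := SaElt { sa_val : set X; sa_valP : sa_pred sa_val }.

HB.instance Definition _ := [isSub for sa_val].
HB.instance Definition _ := [Choice of sa_elt by <:].

Lemma sa_predU : {in sa_pred &, forall Y Z, Y `|` Z \in sa_pred}.
Proof.
by move=> Y Z /set_mem SY /set_mem SZ; apply/mem_set; apply: sa_setU.
Qed.

Lemma sa_predC : {in sa_pred, forall Y, ~` Y \in sa_pred}.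
Proof. by move=> Y /set_mem SY; apply/mem_set; apply: sa_setC. Qed.

Lemma sa_predI : {in sa_pred &, forall Y Z, Y `&` Z \in sa_pred}.
Proof.
move=> Y Z SY SZ; have -> : Y `&` Z = ~` (~` Y `|` ~` Z) by rewrite complU !complK.
by rewrite sa_predC // sa_predU // sa_predC.
Qed.

Lemma sa_pred0 : \bot \in sa_pred.
Proof. by apply/mem_set; apply: sa_set0. Qed.

Lemma sa_pred1 : \top \in sa_pred.
Proof. by rewrite -compl0 sa_predC // sa_pred0. Qed.

HB.instance Definition _ := @Order.isTBLatticeClosed.Build set_display (set X)
  sa_pred sa_predI sa_predU sa_pred0 sa_pred1.
HB.instance Definition _ := [SubChoice_isTBSubLattice of sa_elt by <: with set_display].

Lemma sa_meetUl : left_distributive (@Order.meet _ sa_elt) (@Order.join _ sa_elt).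
Proof. by move=> Y Z W; apply/val_inj; apply: meetUl. Qed.

HB.instance Definition _ :=
  Order.Lattice_Meet_isDistrLattice.Build set_display sa_elt sa_meetUl.

Definition sa_compl (Y : sa_elt) : sa_elt := SaElt (sa_predC (sa_valP Y)).

Lemma sa_joinxC (Y : sa_elt) : Y `|` sa_compl Y = \top.
Proof. by apply/val_inj; apply: joinxC. Qed.

Lemma sa_meetxC (Y : sa_elt) : Y `&` sa_compl Y = \bot.
Proof. by apply/val_inj; apply: meetxC. Qed.

HB.instance Definition _ := Order.TBDistrLattice_hasComplement.Build
  set_display sa_elt sa_joinxC sa_meetxC.

Lemma sa_val0 : sa_val \bot = set0.
Proof. by []. Qed.

Lemma sa_val_compl (Y : sa_elt) : sa_val (~` Y) = (~` sa_val Y)%classic.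
Proof. by []. Qed.

Lemma sa_val_join (Y Z : sa_elt) :
  sa_val (Y `|` Z) = (sa_val Y `|` sa_val Z)%classic.
Proof. by []. Qed.

Lemma sa_eltP (Y Z : sa_elt) : sa_val Y = sa_val Z <-> Y = Z.
Proof. by split=> [/val_inj|->]. Qed.

End SetAlgebra.

(* Main.v *)
(* Stone's theorem represents both Boolean algebras as algebras of sets of     *)
(* prime filters. All the remaining structure is transported along the two     *)
(* resulting isomorphisms; semantic equality of polynomials is preserved, so   *)
(* term and formula interpretations commute with the transport.                *)
Require Import Defs.
From mathcomp Require Import all_boot all_order.
From mathcomp Require Import all_classical.

Set Implicit Arguments.
Unset Strict Implicit.
Unset Printing Implicit Defensive.
Import Order.Theory.
Local Open Scope order_scope.
Local Open Scope quotient_scope.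

(** By Stone's theorem, [A] and [T] are each isomorphic, as Boolean algebras, to a field of subsets
    of their own ultrafilters ([stone_iso]). The modal part is then moved by conjugation: an
    isomorphism [g] of coefficient algebras induces a bijection of polynomials ([poly_mapK]), so
    product, bang, boxes and interpretation can be read back in the old algebra, evaluated there and
    sent forward. The algebra conditions survive because term and formula values commute with this
    transport ([transport_tinterp], [transport_finterp]), while formulas and provability are
    syntactic and do not move. *)

(** * Stone representation of a Boolean algebra *)

Section Stone.

Context (d : Order.disp_t) (A : ctbDistrLatticeType d).
Implicit Types (a b c : A) (U : set A).

Definition proper_lfilter U : Prop :=
  [/\ ~ U \bot, forall a b, a <= b -> U a -> U b
    & forall a b, U a -> U b -> U (a `&` b)].

(** These are the ultrafilters. [plf_ultra] also excludes the empty set, which [proper_lfilter]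
    admits. *)
Record prime_lfilter := PrimeLFilter {
  plf_set :> A -> Prop;
  plf_proper : proper_lfilter plf_set;
  plf_ultra : forall a, plf_set a \/ plf_set (~` a)
}.

Implicit Types F : prime_lfilter.

Lemma plf0 F : ~ F \bot.
Proof. by case: (plf_proper F). Qed.

Lemma plf_le F a b : a <= b -> F a -> F b.
Proof. by case: (plf_proper F) => _ h _; apply: h. Qed.

Lemma plfI F a b : F a -> F b -> F (a `&` b).
Proof. by case: (plf_proper F) => _ _ h; apply: h. Qed.

Lemma plfC F a : F (~` a) <-> ~ F a.
Proof.
split=> [FNa Fa|]; last by case: (plf_ultra F a).
by apply: (@plf0 F); rewrite -(meetxC a); apply: plfI.
Qed.

Lemma plfU F a b : F (a `|` b) <-> F a \/ F b.
Proof.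
split=> [Fab|[]]; [|exact/plf_le/leUl|exact/plf_le/leUr].
case: (pselect (F a)) => [|/plfC FNa]; [by left|right].
apply: plf_le (plfI Fab FNa).
by rewrite meetUl meetxC join0x leIl.
Qed.

Lemma prime_lfilter_exists a : a != \bot -> exists F, F a.
Proof.
move=> a0.
(* The last conjunct puts a in every nonempty member, while the empty set,     *)
(* which is the union of the empty chain, is still allowed.                    *)
pose P U := proper_lfilter U /\ forall b, U b -> U a.
have [|U [[[U0 Ule UI] Ua] Umax]] := @Zorn_bigcup A P.
  move=> C CP Ctot; split; first split.
  - by case=> U CU; have [[]] := CP _ CU.
  - move=> b c bc [U CU Ub]; exists U => //.
    by have [[_ h _] _] := CP _ CU; apply: h Ub.
  - move=> b c [U CU Ub] [V CV Vc].
    have [[_ _ hU] _] := CP _ CU; have [[_ _ hV] _] := CP _ CV.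
    case: (Ctot _ _ CU CV) => sub; [exists V => //; apply: hV|exists U => //; apply: hU] => //;
      exact: sub.
  - by move=> b [U CU Ub]; exists U => //; have [_ h] := CP _ CU; apply: h Ub.
(* If [a] were missing, [U] would be empty, and the principal filter of [a], proper since [a] is
   nonzero, would strictly extend it. *)
have Ua1 : U a.
  apply: contrapT => nUa; apply: (Umax [set c | a <= c]%classic).
    rewrite properEneq; split; last by move=> b /Ua.
    by apply/eqP => UE; apply: nUa; rewrite UE /=.
  split; last by move=> b /=.
  split=> [/=|b c /= bc ab|b c /= ab ac]; first by rewrite lex0; apply/negP.
  - exact: le_trans ab bc.
  - by rewrite lexI ab.
have ultra b : U b \/ U (~` b).
  (* [V] is the filter generated by [U] and [b]. If it contains [\bot], some [u] in [U] is disjoint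
     from [b], hence below its complement; otherwise maximality forces [V] to equal [U], so [b] is
     in [U]. *)
  pose V : set A := fun c => exists2 u, U u & u `&` b <= c.
  case: (pselect (V \bot)) => [[u Uu]|V0].
    by rewrite lex0 => /eqP ub; right; apply: Ule Uu; rewrite -disj_leC ub.
  have UV : (U `<=` V)%classic by move=> c Uc; exists c => //; apply: leIl.
  left; apply: contrapT => nUb; apply: (Umax V).
    rewrite properEneq; split=> //; apply/eqP => UE; apply: nUb.
    by rewrite UE; exists a => //; apply: leIr.
  split; last by move=> _ _; apply: UV.
  split=> // [c e ce [u Uu uc]|c e [u Uu uc] [w Uw we]].
    by exists u => //; apply: le_trans ce.
  exists (u `&` w); first exact: UI.
  by rewrite lexI (le_trans _ uc) ?(le_trans _ we) ?leI2 ?leIl ?leIr.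
by exists (@PrimeLFilter U (And3 U0 Ule UI) ultra).
Qed.

Definition stone_set a : set prime_lfilter := [set F : prime_lfilter | F a]%classic.

Lemma stone_set0 : stone_set \bot = set0.
Proof. by rewrite -subset0 => F /plf0. Qed.

Lemma stone_setC a : stone_set (~` a) = (~` stone_set a)%classic.
Proof. by apply/seteqP; split=> F /plfC. Qed.

Lemma stone_setU a b :
  stone_set (a `|` b) = (stone_set a `|` stone_set b)%classic.
Proof. by apply/seteqP; split=> F /plfU. Qed.

Lemma stone_set_inj : injective stone_set.
Proof.
suff le a b : stone_set a = stone_set b -> a <= b.
  by move=> a b ab; apply/le_anti/andP; split; apply: le.
move=> ab; rewrite -[b]complK -disj_leC; apply/negPn/negP.
case/prime_lfilter_exists => F Fab.
have : stone_set a F by apply: plf_le Fab; apply: leIl.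
rewrite ab; apply/plfC; apply: plf_le Fab; exact: leIr.
Qed.

Lemma stone_range0 : range stone_set set0.
Proof. by exists \bot => //; apply: stone_set0. Qed.

Lemma stone_rangeC Y : range stone_set Y -> range stone_set (~` Y)%classic.
Proof. by case=> a _ <-; exists (~` a) => //; apply: stone_setC. Qed.

Lemma stone_rangeU Y Z : range stone_set Y -> range stone_set Z ->
  range stone_set (Y `|` Z)%classic.
Proof.
by case=> a _ <- [b _ <-]; exists (a `|` b) => //; apply: stone_setU.
Qed.

Definition stone_algebra : set_algebra prime_lfilter :=
  SetAlgebra stone_range0 stone_rangeC stone_rangeU.

Lemma stone_subproof a : sa_pred stone_algebra (stone_set a).
Proof. by apply/mem_set; exists a. Qed.

Definition stone a : sa_elt stone_algebra := SaElt (stone_subproof a).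

Lemma stone_iso : bool_iso stone.
Proof.
split.
- have surj (Y : sa_elt stone_algebra) : exists a, stone a = Y.
    have /set_mem [a _ aY] := sa_valP Y.
    by exists a; apply/sa_eltP.
  have [h hK] := choice surj.
  exists h => // a; apply: stone_set_inj.
  by have /sa_eltP := hK (stone a).
- by apply/sa_eltP; apply: stone_set0.
- by move=> a; apply/sa_eltP; apply: stone_setC.
- by move=> a b; apply/sa_eltP; apply: stone_setU.
Qed.

End Stone.

(** * Boolean isomorphisms and the induced maps of polynomials *)

Section BoolIso.

Context (d d' : Order.disp_t).
Context (A : ctbDistrLatticeType d) (A' : ctbDistrLatticeType d').
Context (f : A -> A') (f_iso : bool_iso f).

Lemma bool_iso1 : f \top = \top.
Proof. by case: f_iso => _ f0 fC _; rewrite -compl0 fC f0 compl0. Qed.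

Lemma bool_isoI : {morph f : a b / a `&` b}.
Proof.
case: f_iso => _ _ fC fU a b.
by rewrite -[a `&` b]complK complI fC fU !fC complU !complK.
Qed.

Lemma bool_iso_le a b : a <= b -> f a <= f b.
Proof. by rewrite !leEmeet -bool_isoI => /eqP ->. Qed.

Lemma bool_iso_inv (h : A' -> A) : cancel f h -> cancel h f -> bool_iso h.
Proof.
case: f_iso => _ f0 fC fU fK hK; split.
- by exists f.
- by rewrite -f0 fK.
- by move=> a; apply: (can_inj fK); rewrite fC !hK.
- by move=> a b; apply: (can_inj fK); rewrite fU !hK.
Qed.

Context (Var : Type).
Local Notation G := (@poly_map Var _ _ A A' f).

Lemma pval_map v (p : polynomial Var A) : pval (f \o v) (G p) = f (pval v p).
Proof. by rewrite /poly_map pval_pi peval_map. Qed.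

Lemma poly_map_coef a : G (pcoef Var a) = pcoef Var (f a).
Proof. by rewrite /pcoef poly_map_pi. Qed.

Lemma poly_map_var x : G (pvar A x) = pvar A' x.
Proof. by rewrite /pvar poly_map_pi. Qed.

Lemma poly_mapC p : G (~` p) = ~` G p.
Proof.
have [[h _ hK] _ fC _] := f_iso; apply/polyP => v.
(* Since [f] is onto, every valuation factors through [f], which is the form [pval_map] needs. *)
have -> : v = f \o (h \o v) by apply/funext => x /=; rewrite hK.
by rewrite !pneg_compl pval_map !pval_neg pval_map fC.
Qed.

Lemma poly_mapU p q : G (p `|` q) = G p `|` G q.
Proof.
have [[h _ hK] _ _ fU] := f_iso; apply/polyP => v.
have -> : v = f \o (h \o v) by apply/funext => x /=; rewrite hK.
by rewrite !padd_join pval_map !pval_add !pval_map fU.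
Qed.

End BoolIso.

Lemma poly_mapK (d d' : Order.disp_t) (Var : Type) (T : ctbDistrLatticeType d)
    (T' : ctbDistrLatticeType d') (g : T -> T') (h : T' -> T) :
  bool_iso g -> cancel g h -> cancel h g ->
  cancel (@poly_map Var _ _ T T' g) (poly_map h).
Proof.
move=> giso gK hK p; have hiso := bool_iso_inv giso gK hK.
apply/polyP => v.
have -> : v = h \o (g \o v) by apply/funext => x /=; rewrite gK.
by rewrite !pval_map // gK; congr pval; apply/funext => x /=; rewrite gK.
Qed.

(** * Transport of the algebra along a pair of isomorphisms *)

Section Transport.

Context (Const : Type) (Var : eqType) (Atom : Type).
Context (CS : set (form Const Var Atom)).
Context (dA dT dA' dT' : Order.disp_t).
Context (A : ctbDistrLatticeType dA) (T : ctbDistrLatticeType dT).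
Context (A' : ctbDistrLatticeType dA') (T' : ctbDistrLatticeType dT').
Context (TT : poly_structure Var T) (AA : poly_algebra CS A TT).
Context (f : A -> A') (f' : A' -> A) (g : T -> T') (g' : T' -> T).
Context (f_iso : bool_iso f) (f'K : cancel f' f).
Context (g_iso : bool_iso g) (gK : cancel g g') (g'K : cancel g' g).

Local Notation G := (@poly_map Var _ _ T T' g).
Local Notation H := (@poly_map Var _ _ T' T g').

Let g'_iso : bool_iso g' := bool_iso_inv g_iso gK g'K.
Let GK : cancel G H := poly_mapK g_iso gK g'K.
Let HK : cancel H G := poly_mapK g'_iso g'K gK.

(** The operations on polynomials are arbitrary extensions, not determined by those on coefficients,
    so both levels are conjugated separately; [poly_map_coef] shows that they still agree. *)
Definition transport_tdot a b := g (tdot TT (g' a) (g' b)).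
Definition transport_tbang a := g (tbang TT (g' a)).
Definition transport_pdot p q := G (pdot TT (H p) (H q)).
Definition transport_pbang p := G (pbang TT (H p)).

Lemma transport_pdot_coef a b :
  transport_pdot (pcoef Var a) (pcoef Var b) = pcoef Var (transport_tdot a b).
Proof. by rewrite /transport_pdot !poly_map_coef // pdot_coef poly_map_coef. Qed.

Lemma transport_pbang_coef a :
  transport_pbang (pcoef Var a) = pcoef Var (transport_tbang a).
Proof. by rewrite /transport_pbang poly_map_coef // pbang_coef poly_map_coef. Qed.

Definition transport_structure : poly_structure Var T' :=
  PolyStructure transport_pdot_coef transport_pbang_coef.

Definition transport_box p q := f (box AA (H p) q).
Definition transport_interp c := g (interp AA c).

Lemma transport_interp0 : transport_interp None = \bot.
Proof. by rewrite /transport_interp interp0; case: g_iso. Qed.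

Lemma transport_box_app p q a b :
  transport_box a (FImp p q) `&` transport_box b p
    <= transport_box (pdot transport_structure a b) q.
Proof.
rewrite /transport_box -bool_isoI //; apply: bool_iso_le => //.
by rewrite /= /transport_pdot GK box_app.
Qed.

Lemma transport_box_add p a b :
  transport_box a p `|` transport_box b p <= transport_box (a `|` b) p.
Proof.
have [_ _ _ fU] := f_iso.
by rewrite /transport_box poly_mapU // -fU bool_iso_le // box_add.
Qed.

Lemma transport_box_one p :
  provable CS p -> transport_box (pcoef Var \top) p = \top.
Proof.
by move=> ?; rewrite /transport_box poly_map_coef // bool_iso1 // box_one // bool_iso1.
Qed.

Lemma transport_box_cs c p : CS (FJust (TConst c) p) ->
  transport_box (pcoef Var (transport_interp (Some c))) p = \top.
Proof.
move=> ?; rewrite /transport_box poly_map_coef // /transport_interp gK.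
by rewrite box_cs // bool_iso1.
Qed.

Definition transport_pre : pre_poly_algebra CS A' transport_structure :=
  PrePolyAlgebra transport_interp0 transport_box_app transport_box_add
    transport_box_one transport_box_cs.

Lemma transport_tinterp t :
  tinterp transport_structure transport_interp t = G (tinterp TT (interp AA) t).
Proof.
elim: t => //= [c|x||s ->|s -> u ->|s -> u ->|s ->].
- by rewrite poly_map_coef.
- by rewrite poly_map_var.
- by rewrite poly_map_coef.
- by rewrite poly_mapC.
- by rewrite poly_mapU.
- by rewrite /transport_pdot !GK.
- by rewrite /transport_pbang GK.
Qed.

(** Soundness quantifies over all valuations, so a valuation in [A'] can be pulled back along [f']
    and the original [box_sound] applied. Boxes take formulas as syntax, so the justification case
    needs only [transport_tinterp]. *)
Lemma transport_finterp theta p :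
  finterp transport_pre theta p = f (finterp AA (f' \o theta) p).
Proof.
have [_ f0 fC fU] := f_iso.
elim: p => [x|s t||q IH|q IHq r IHr|t q _] /=.
- by rewrite f'K.
- rewrite !transport_tinterp.
  (* [G] is injective, so it neither creates nor destroys equalities between term values. *)
  rewrite (_ : `[< _ >] = `[< tinterp TT (interp AA) s = tinterp TT (interp AA) t >]).
    by case: ifP; rewrite ?bool_iso1.
  by apply: asbool_equiv_eq; split=> [/(can_inj GK)|->].
- by rewrite f0.
- by rewrite IH fC.
- by rewrite IHq IHr fU.
- by rewrite transport_tinterp /transport_box GK.
Qed.

Lemma transport_box_bang p t :
  box transport_pre (tinterp transport_structure (interp transport_pre) t) p
    <= box transport_pre
         (pbang transport_structure
           (tinterp transport_structure (interp transport_pre) t)) (FJust t p).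
Proof.
rewrite /= transport_tinterp /transport_box /transport_pbang !GK.
by apply: bool_iso_le => //; apply: box_bang.
Qed.

Lemma transport_box_sound p a theta :
  box transport_pre a p <= finterp transport_pre theta p.
Proof. by rewrite transport_finterp; apply: bool_iso_le => //; apply: box_sound. Qed.

Definition transport_algebra : poly_algebra CS A' transport_structure :=
  PolyAlgebra transport_box_bang transport_box_sound.

Lemma transport_bi_isomorphic : bi_isomorphic AA transport_algebra.
Proof.
exists f, g; split=> //= [a p|]; first by rewrite /transport_box GK.
by split=> // [a b|a]; rewrite /transport_pdot /transport_pbang !GK.
Qed.

End Transport.

Theorem theorem6p13 (Const : Type) (Var : eqType) (Atom : Type)
    (CS : set (form Const Var Atom)) (hCS : constant_spec CS)
    (dA dT : Order.disp_t)
    (A : ctbDistrLatticeType dA) (T : ctbDistrLatticeType dT)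
    (TT : poly_structure Var T) (AA : poly_algebra CS A TT) :
  exists (X Y : Type) (SA : set_algebra X) (SB : set_algebra Y)
    (BB : poly_structure Var (sa_elt SB))
    (AA' : poly_algebra CS (sa_elt SA) BB),
    bi_isomorphic AA AA'.
Proof.
have [[f' _ f'K] _ _ _] := stone_iso A.
have [[g' gK g'K] _ _ _] := stone_iso T.
(* The two set algebras live on different spaces: the ultrafilters of [A] and those of [T]. *)
exists (prime_lfilter A), (prime_lfilter T), (stone_algebra A), (stone_algebra T).
exists (transport_structure TT (stone_iso T) gK g'K).
exists (transport_algebra AA (stone_iso A) f'K (stone_iso T) gK g'K).
exact: transport_bi_isomorphic.
Qed.
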